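(* Let $n\ge1$ and let $G=\mathrm{PSL}(2,2^n)$ act on the $13$-subsets of $X=\mathrm{GF}(2^n)\cup\{\infty\}$. Then \[m_{143}=\begin{cases}\dfrac{2^n-4}{12} & \text{if } n \text{ is even},\\[2mm] 0 & \text{if } n\text{ is odd}.\end{cases}\]
   Context: $\mathrm{PSL}(2,2^n)$ is the group of all maps $X\to X$, $x\mapsto\frac{ax+b}{cx+d}$ with $a,b,c,d\in\mathrm{GF}(2^n)$, $ad-bc\neq0$ (usual conventions for $\infty$). For a $13$-subset $B$ of $X$, $G_B=\{g\in G: g(B)=B\}$ and $G(B)=\{g(B):g\in G\}$. Each orbit $G(B)$ is a simple $3$-$(2^n+1,13,\lambda_B)$ design (every $3$-subset of $X$ lies in exactly $\lambda_B$ members of $G(B)$), with $\lambda_B=1716/|G_B|$. $m_\lambda$ denotes the number of $G$-orbits $G(B)$ of $13$-subsets with $\lambda_B=\lambda$; so $m_{143}$ counts the orbits with $|G_B|=12$. *)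

(* Defs.v *)
From mathcomp Require Import all_boot all_order all_algebra all_fingroup.
From mathcomp Require Import ring.

Set Implicit Arguments.
Unset Strict Implicit.
Unset Printing Implicit Defensive.

Import GRing.Theory.
Local Open Scope ring_scope.

(* The projective line is [option F], with [None] the point at infinity. *)
Definition moebius (F : fieldType) (a b c d : F) (x : option F) : option F :=
  match x with
  | Some y => if c * y + d == 0 then None else Some ((a * y + b) / (c * y + d))
  | None => if c == 0 then None else Some (a / c)
  end.

Lemma moebius_comp (F : fieldType) (a b c d e f g h : F) (x : option F) :
  a * d - b * c != 0 -> e * h - f * g != 0 ->
  moebius e f g h (moebius a b c d x) =
  moebius (e * a + f * c) (e * b + f * d) (g * a + h * c) (g * b + h * d) x.
Proof.
move=> D1 D2.
have key (u v : F) : (u != 0) || (v != 0) ->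
    (if (if v == 0 then None else Some (u / v)) is Some y
     then if g * y + h == 0 then None else Some ((e * y + f) / (g * y + h))
     else if g == 0 then None else Some (e / g)) =
    (if g * u + h * v == 0 then None
     else Some ((e * u + f * v) / (g * u + h * v))).
  case: (eqVneq v 0) => [->|v0] /=.
    rewrite orbF => u0; rewrite !mulr0 !addr0 mulf_eq0 (negPf u0) orbF.
    by case: (eqVneq g 0) => // g0; congr Some; field; rewrite ?g0 ?u0.
  move=> _; have -> : g * (u / v) + h = (g * u + h * v) / v by field.
  rewrite mulf_eq0 invr_eq0 (negPf v0) orbF.
  by case: (eqVneq (g * u + h * v) 0) => // w0; congr Some; field; rewrite v0 w0.
case: x => [y|]; rewrite /moebius.
  have -> : (g * a + h * c) * y + (g * b + h * d) =
            g * (a * y + b) + h * (c * y + d) by ring.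
  have -> : (e * a + f * c) * y + (e * b + f * d) =
            e * (a * y + b) + f * (c * y + d) by ring.
  rewrite -key //; apply: contraR D1; rewrite negb_or !negbK.
  case/andP=> /eqP p0 /eqP q0; apply/eqP.
  case: (eqVneq c 0) => [c0|c0].
    move: p0 q0; rewrite c0 mul0r add0r => p0 ->; ring.
  have -> : a * d - b * c = a * (c * y + d) - c * (a * y + b) by ring.
  by rewrite p0 q0; ring.
rewrite -key //; apply: contraR D1; rewrite negb_or !negbK.
by case/andP=> /eqP -> /eqP ->; apply/eqP; ring.
Qed.

(* In characteristic 2, the intended case, every nonzero determinant is a square,
   so asking for a nonzero determinant gives PSL(2, F), not a larger group. *)
Definition PSL2 (F : finFieldType) : {set {perm (option F)}} :=
  [set s : {perm (option F)} | [exists a, exists b, exists c, exists d,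
     (a * d - b * c != 0) && [forall x, s x == moebius a b c d x]]].

Lemma PSL2P (F : finFieldType) (s : {perm (option F)}) :
  reflect (exists a b c d : F, a * d - b * c != 0 /\ s =1 moebius a b c d)
          (s \in PSL2 F).
Proof.
rewrite inE; apply: (iffP existsP) => [[a]|[a [b [c [d [D E]]]]]].
  case/existsP=> b /existsP[c /existsP[d /andP[D /forallP E]]].
  by exists a, b, c, d; split=> // x; apply/eqP.
exists a; apply/existsP; exists b; apply/existsP; exists c; apply/existsP.
by exists d; rewrite D; apply/forallP=> x; rewrite E.
Qed.

Lemma moebius_id (F : fieldType) (r : F) (x : option F) :
  r != 0 -> moebius r 0 0 r x = x.
Proof.
move=> r0; case: x => [y|] /=; last by rewrite eqxx.
by rewrite mul0r add0r (negPf r0); congr Some; field; rewrite r0.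
Qed.

Lemma moebius_inj (F : fieldType) (a b c d : F) :
  a * d - b * c != 0 -> injective (moebius a b c d).
Proof.
move=> D; apply: (can_inj (g := moebius d (- b) (- c) a)) => x.
rewrite moebius_comp //; last by rewrite mulrNN [d * a]mulrC.
have -> : d * b + - b * d = 0 by ring.
have -> : - c * a + a * c = 0 by ring.
have -> : d * a + - b * c = a * d - b * c by ring.
have -> : - c * b + a * d = a * d - b * c by ring.
exact: moebius_id.
Qed.

(* Every fractional linear map is a permutation, so none is lost in [PSL2]. *)
Lemma PSL2_moebius (F : finFieldType) (a b c d : F)
    (D : a * d - b * c != 0) : perm (moebius_inj D) \in PSL2 F.
Proof. by apply/PSL2P; exists a, b, c, d; split=> // x; rewrite permE. Qed.

Lemma PSL2_group_set (F : finFieldType) : group_set (PSL2 F).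
Proof.
apply/group_setP; split=> [|s t].
  apply/PSL2P; exists 1, 0, 0, 1; split=> [|x].
    by rewrite mulr1 mulr0 subr0 oner_eq0.
  by rewrite perm1 moebius_id ?oner_eq0.
case/PSL2P=> [a [b [c [d [D1 E1]]]]] /PSL2P[e [f [g [h [D2 E2]]]]].
apply/PSL2P.
exists (e * a + f * c), (e * b + f * d), (g * a + h * c), (g * b + h * d).
split=> [|x]; last by rewrite permM E2 E1 moebius_comp.
have -> : (e * a + f * c) * (g * b + h * d) - (e * b + f * d) * (g * a + h * c)
          = (a * d - b * c) * (e * h - f * g) by ring.
by rewrite mulf_neq0.
Qed.

Canonical PSL2_group (F : finFieldType) := Group (PSL2_group_set F).

(* Blocks form a set, so there are no repeated blocks: the design is simple. *)
Definition simple_design (t v k l : nat) (X : finType) (D : {set {set X}}) :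
    bool :=
  [&& #|X| == v,
      [forall B in D, #|B| == k] &
      [forall T : {set X}, (#|T| == t) ==>
         (#|[set B in D | T \subset B]| == l)]].

Definition PSL2_orbits (F : finFieldType) (k : nat) :
    {set {set {set option F}}} :=
  [set orbit ('P^*)%act (PSL2 F) B | B : {set option F} & #|B| == k].

(* The number of orbits G(B) of 13-subsets B of the projective
   line whose design parameter lambda_B is l. *)
Definition m_lambda (F : finFieldType) (l : nat) : nat :=
  #|[set D in PSL2_orbits F 13 | simple_design 3 #|F|.+1 13 l D]|.

(* Main.v *)
Require Import Defs.
From mathcomp Require Import all_boot all_order all_algebra all_fingroup.
From mathcomp Require Import pgroup sylow finfield cyclic.
From mathcomp Require Import ring.

Import GRing.Theory.
Local Open Scope ring_scope.

Set Implicit Arguments.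
Unset Strict Implicit.
Unset Printing Implicit Defensive.

(** Let [G = PSL(2, 2^n)], acting on the projective line [X = F + infinity].

    Sharp 3-transitivity of [G] gives [lambda_B * |G_B| = 13 * 12 * 11 = 1716]
    for every 13-subset [B] ([card_blocks_stab]), so [lambda_B = 143] means
    [|G_B| = 12], and in any case [|G_B|] divides [1716 = 4 * 3 * 11 * 13].

    A subgroup [K] of order 12 has a Sylow 2-subgroup with a fixed point, since
    [|X|] is odd; placed at infinity, that point is fixed by all of [K]. An
    element of order 3 in [K] then has as multiplier a primitive cube root of
    unity [w] of [F], which rules out odd [n], and normalizing coordinates turns
    [K] into [H = AGL(1, 4)], the maps [x -> a x + b] with [a], [b] in GF(4) and
    [a] nonzero ([order12_conj]).

    The orbits of [H] on [X] are infinity, GF(4), and regular orbits of size 12.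
    Hence its invariant 13-subsets are the sets [infinity + O] with [O] a regular
    orbit ([invariant_block]). The stabilizer of such a set is no larger than
    [H] ([block_stab]): a larger one moves infinity and so has order
    [13 * 12 = 156], and Sylow's theorem at 13 excludes this
    ([card_overgroup_neq156]). Finally [H] is its own normalizer in [G]
    ([agl4_self_normalizing]), so distinct [O] give distinct [G]-orbits. The
    number sought is that of the regular orbits, [(2^n - 4) / 12]. *)

(** * Affine maps and sharp 3-transitivity *)

Section Affine.

Variable F : finFieldType.
Implicit Types (a b c d x y : F) (p q : option F) (s t g : {perm (option F)}).

Local Notation G := (PSL2_group F).

Definition aff_fun a b p : option F := omap (fun y => a * y + b) p.

Lemma aff_fun_inj a b : a != 0 -> injective (aff_fun a b).
Proof. by move=> a0 [x|] [y|] //= [] /addIr /(mulfI a0) ->. Qed.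

(** Extending by the identity at [a = 0] makes this total, so that no proof
    that [a] is nonzero is carried inside the term. *)
Definition aff a b : {perm (option F)} :=
  if eqVneq a 0 is NeqNotEq a0 then perm (aff_fun_inj (b := b) a0) else 1%g.

(* Without this, [a^-1] under [%g] would be read in the additive group of F. *)
Arguments aff a%_R b%_R.

Lemma affE a b p : a != 0 -> aff a b p = aff_fun a b p.
Proof. by rewrite /aff; case: eqVneq => // a0 _; rewrite permE. Qed.

Lemma affN a b : aff a b None = None.
Proof. by rewrite /aff; case: eqVneq => // a0; rewrite ?permE ?perm1. Qed.

Lemma affS a b x : a != 0 -> aff a b (Some x) = Some (a * x + b).
Proof. exact: affE. Qed.

Lemma affM a b c d : a != 0 -> c != 0 ->
  (aff a b * aff c d)%g = aff (c * a) (c * b + d).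
Proof.
move=> a0 c0; apply/permP => -[x|]; rewrite permM ?affN //.
by rewrite !affS ?mulf_neq0 //; congr Some; ring.
Qed.

Lemma aff1 : aff 1 0 = 1%g.
Proof.
apply/permP => -[x|]; rewrite perm1 ?affN // affS ?oner_eq0 //.
by rewrite mul1r addr0.
Qed.

Lemma affV a b : a != 0 -> (aff a b)^-1%g = aff a^-1 (- (a^-1 * b)).
Proof.
move=> a0; apply/eqP; rewrite eq_invg_mul affM ?invr_eq0 //.
by rewrite mulVf // subrr aff1.
Qed.

Lemma aff_inj a b c d : a != 0 -> c != 0 -> aff a b = aff c d -> a = c /\ b = d.
Proof.
move=> a0 c0 E.
have := congr1 (fun s : {perm (option F)} => s (Some 0)) E.
rewrite !affS // !mulr0 !add0r => -[Eb].
have := congr1 (fun s : {perm (option F)} => s (Some 1)) E.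
by rewrite !affS // !mulr1 Eb => -[/addIr].
Qed.

Lemma affJ a b c d : a != 0 -> c != 0 ->
  (aff c d ^ aff a b)%g = aff c (a * d + b - c * b).
Proof.
move=> a0 c0; rewrite conjgE affV // !affM ?mulf_neq0 ?invr_eq0 //.
by congr aff; field.
Qed.

Lemma trans_fix c p : c != 0 -> aff 1 c p = p -> p = None.
Proof.
move=> c0; case: p => // x; rewrite affS ?oner_eq0 // mul1r => -[/eqP].
by rewrite -subr_eq0 addrAC subrr add0r (negPf c0).
Qed.

Lemma aff_G a b : a != 0 -> aff a b \in G.
Proof.
move=> a0; apply/PSL2P; exists a, b, 0, 1; split=> [|[x|]] /=.
- by rewrite mulr1 mulr0 subr0.
- by rewrite affS // mul0r add0r oner_eq0 divr1.
- by rewrite affN eqxx.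
Qed.

(** Fixing infinity forces [c = 0], after which [d] can be divided out. *)
Lemma G_fix_inf s : s \in G -> s None = None ->
  exists2 a, a != 0 & exists b, s = aff a b.
Proof.
case/PSL2P=> a [b [c [d [D E]]]] sN.
have c0 : c = 0 by move: sN; rewrite E /=; case: eqP.
move: D; rewrite c0 mulr0 subr0 mulf_eq0 negb_or => /andP[a0 d0].
exists (a / d); first by rewrite mulf_neq0 ?invr_eq0.
exists (b / d); apply/permP => -[x|]; last by rewrite affN sN.
rewrite E affS ?mulf_neq0 ?invr_eq0 //= c0 mul0r add0r (negPf d0).
by congr Some; field.
Qed.

Lemma G_to_inf p : exists2 g, g \in G & g p = None.
Proof.
case: p => [y|]; last by exists 1%g; rewrite ?group1 ?perm1.
have D : 0 * (- y) - 1 * 1 != 0 by rewrite mul0r sub0r mulr1 oppr_eq0 oner_eq0.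
exists (perm (moebius_inj D)); first exact: PSL2_moebius.
by rewrite permE /= mul1r subrr eqxx.
Qed.

Lemma G_to_triple (u : 3.-tuple (option F)) : uniq u ->
  exists2 g, g \in G & map g u = [:: None; Some 0; Some 1].
Proof.
case/tupleP: u => p u; case/tupleP: u => q u; case/tupleP: u => r u.
rewrite (tuple0 u) /= !inE andbT negb_or => /andP[/andP[pq pr] qr].
have [g gG gp] := G_to_inf p.
case Eq: (g q) => [x|]; last by rewrite -(inj_eq (@perm_inj _ g)) gp Eq in pq.
case Er: (g r) => [y|]; last by rewrite -(inj_eq (@perm_inj _ g)) gp Er in pr.
have xy : y - x != 0.
  by rewrite subr_eq0 eq_sym; move: qr; rewrite -(inj_eq (@perm_inj _ g)) Eq Er.
exists (g * aff (y - x)^-1 (- (x / (y - x))))%g.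
  by rewrite groupM ?aff_G ?invr_eq0.
rewrite !permM gp Eq Er affN !affS ?invr_eq0 //.
by congr [:: _; Some _; Some _]; field.
Qed.

Lemma G_triple_fix s : s \in G ->
  map s [:: None; Some 0; Some 1] = [:: None; Some 0; Some 1] -> s = 1%g.
Proof.
move=> sG [sN]; have [a a0 [b ->]] := G_fix_inf sG sN.
rewrite !affS // mulr0 add0r mulr1 => -[->]; rewrite addr0 => -[->].
exact: aff1.
Qed.

(** Two elements agreeing on a triple, and the element taking one triple to
    another, both come from the normal form (infinity, 0, 1). *)
Lemma G_triple_inj (u : 3.-tuple (option F)) g t : uniq u ->
  g \in G -> t \in G -> map g u = map t u -> g = t.
Proof.
move=> /G_to_triple[h hG hu] gG tG E.
apply: (mulIg t^-1%g); rewrite mulgV; apply: (conjg_inj h); rewrite conj1g.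
apply: G_triple_fix; first by rewrite groupJ ?groupM ?groupV.
rewrite conjgE -hu -map_comp; apply/eq_in_map => p pu /=.
rewrite !permM permK; congr (h _).
suff -> : g p = t p by rewrite permK.
by move/eq_in_map: E; apply.
Qed.

Lemma G_triple_trans (u v : 3.-tuple (option F)) : uniq u -> uniq v ->
  exists2 g, g \in G & map g u = v.
Proof.
move=> /G_to_triple[g gG gu] /G_to_triple[h hG hv].
exists (g * h^-1)%g; first by rewrite groupM ?groupV.
rewrite -(mapK (permK h) v) hv -gu -map_comp.
by apply: eq_map => p; rewrite /= permM.
Qed.

End Affine.

Arguments aff {F} a%_R b%_R.

(** * The design parameter of an orbit *)

Section Design.

Variable F : finFieldType.
Implicit Types (B T : {set option F}) (s t g : {perm (option F)}).

Local Notation G := (PSL2_group F).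
Local Notation stab B := ('C_G[B | ('P^*)%act])%g.
Local Notation orb B := (orbit ('P^*)%act G B).

Lemma setactPE B g : (('P^*)%act B g : {set option F}) = [set g x | x in B].
Proof. exact: setactE. Qed.

Lemma card_movers_uniq B (u : 3.-tuple (option F)) : uniq u ->
  #|[set g in G | all (fun x => x \in [set g y | y in B]) u]| = (#|B| ^_ 3)%N.
Proof.
move=> uu; set A := [set g in G | _].
pose f (g : {perm (option F)}) := map_tuple g^-1%g u.
have fi : {in A &, injective f}.
  move=> g t /setIdP[gG _] /setIdP[tG _] /(congr1 val) /= E.
  by apply: invg_inj; apply: G_triple_inj uu _ _ E; rewrite groupV.
rewrite -(card_in_imset fi) -card_uniq_tuples; apply: eq_card => v.
rewrite inE; apply/imsetP/andP => [[g /setIdP[gG /allP uB] ->]|[vB uv]].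
  split; last first.
    by rewrite map_inj_uniq //; apply: perm_inj.
  apply/allP => _ /mapP[x xu ->]; have /imsetP[y yB ->] := uB x xu.
  by rewrite permK.
have [g gG gv] := G_triple_trans uv uu.
exists g; last by apply: val_inj; rewrite /= -gv mapK //; apply: permK.
apply/setIdP; split=> //; rewrite -gv; apply/allP => _ /mapP[x xv ->].
by apply: imset_f; apply: (allP vB).
Qed.

(** Double counting of the [g] in [G] with [T] inside [g B]: sharp
    3-transitivity makes them correspond to the ordered triples of distinct
    points of [B], and each block [g B] containing [T] arises from a coset
    of the stabilizer of [B]. *)
Lemma card_blocks_stab B T : #|T| = 3%N ->
  (#|[set B' in orb B | T \subset B']| * #|stab B| = #|B| ^_ 3)%N.
Proof.
move=> T3; have sT : size (enum T) == 3 by rewrite -cardE T3.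
have uT : uniq (Tuple sT) by exact: enum_uniq.
rewrite -(card_movers_uniq B uT) -[RHS]sum1_card.
rewrite (partition_big (fun g => ('P^*)%act B g)
           (mem [set B' in orb B | T \subset B'])) /=; last first.
  move=> g /setIdP[gG /allP TB]; rewrite inE.
  rewrite mem_orbit //= setactPE; apply/subsetP => x xT.
  by apply: TB; rewrite mem_enum.
rewrite -sum_nat_const; apply: eq_bigr => B'.
rewrite inE => /andP[/orbitP[a aG <-] TB'].
rewrite sum1_card -(card_rcoset _ a) -amove_act ?subsetT //.
apply: eq_card => g; rewrite [in RHS]unfold_in /=.
apply/setIdP/andP => [[gG /eqP Eg] | [/setIdP[gG _] Eg] //].
split; last exact/eqP.
apply/setIdP; split=> //; apply/allP => x; rewrite mem_enum => xT.
by rewrite -setactPE /= Eg; apply: (subsetP TB').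
Qed.

Lemma card_projline : #|{: option F}| = #|F|.+1.
Proof. by rewrite card_option. Qed.

Lemma card_stab_dvd B : #|B| = 13%N -> (#|stab B| %| 1716)%N.
Proof.
move=> B13; have /card_geqP[r [ur sr _]] : (2 < #|B|)%N by rewrite B13.
have T3 : #|[set x in r]| = 3%N by rewrite cardsE (card_uniqP ur).
have := card_blocks_stab B T3; rewrite B13 => E.
by rewrite -[1716%N]/(13 ^_ 3)%N -E dvdn_mull.
Qed.

Lemma simple_designE B : #|B| = 13%N ->
  simple_design 3 #|F|.+1 13 143 (orb B) = (#|stab B| == 12%N).
Proof.
move=> B13; rewrite /simple_design card_projline eqxx /=.
have -> : [forall B' in orb B, #|B'| == 13].
  apply/forall_inP => _ /orbitP[a _ <-].
  by rewrite setactPE card_imset ?B13 //; apply: perm_inj.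
apply/forallP/eqP => [bl|K12 T].
  have /card_geqP[r [ur sr _]] : (2 < #|B|)%N by rewrite B13.
  have T3 : #|[set x in r]| = 3%N by rewrite cardsE (card_uniqP ur).
  have := card_blocks_stab B T3; have /implyP := bl [set x in r].
  rewrite T3 B13 => /(_ isT) /eqP -> E.
  by apply/eqP; rewrite -(eqn_pmul2l (m := 143)) // E.
apply/implyP => /eqP T3; have := card_blocks_stab B T3.
by rewrite B13 K12 => E; rewrite -(eqn_pmul2r (m := 12)) // E.
Qed.

End Design.

(** * The affine group over GF(4) *)

Section AffineGF4.

Variable F : finFieldType.
Hypothesis char2 : 2 \in [pchar F].
Implicit Types (a b c x y : F) (p : option F) (s t g : {perm (option F)}).

Local Notation G := (PSL2_group F).

(** The roots of [X^4 - X] are closed under the field operations in every field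
    of characteristic 2; they form GF(4) once a primitive cube root of unity
    exists, and GF(2) otherwise. *)
Definition gf4 : {set F} := [set x | x ^+ 4 == x].

(** This is AGL(1, 4), by [agl4P]; as an intersection of stabilizers it is a
    group without further proof. *)
Definition agl4 : {group {perm (option F)}} :=
  ('C_G[None | 'P] :&: 'C[[set Some x | x in gf4] | ('P^*)%act])%G.

Local Notation H := agl4.

Lemma gf4D x y : x \in gf4 -> y \in gf4 -> x + y \in gf4.
Proof.
rewrite !inE => /eqP Ex /eqP Ey.
have dbl := addrr_pchar2 char2.
rewrite -[X in _ == X + y]Ex -[X in _ == _ + X]Ey; apply/eqP.
have -> : (x + y) ^+ 4 = x ^+ 4 + y ^+ 4 +
  (2 * x ^+ 3 * y + 3 * x ^+ 2 * y ^+ 2 + 2 * x * y ^+ 3) * (1 + 1) by ring.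
by rewrite dbl mulr0 addr0.
Qed.

Lemma gf4M x y : x \in gf4 -> y \in gf4 -> x * y \in gf4.
Proof. by rewrite !inE exprMn => /eqP -> /eqP ->. Qed.

Lemma gf4V x : x \in gf4 -> x^-1 \in gf4.
Proof. by rewrite !inE exprVn => /eqP ->. Qed.

Lemma gf4_0 : 0 \in gf4.
Proof. by rewrite inE expr0n. Qed.

Lemma gf4_1 : 1 \in gf4.
Proof. by rewrite inE expr1n. Qed.

Lemma aff_agl4 a b : a \in gf4 -> a != 0 -> b \in gf4 -> aff a b \in H.
Proof.
move=> aK a0 bK; apply/setIP; split.
  by apply/setIP; split; [exact: aff_G | apply/astab1P; rewrite /= apermE affN].
apply/astab1P; rewrite setactPE; apply/eqP; rewrite eqEcard.
rewrite (card_imset _ (@perm_inj _ _)) leqnn andbT.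
apply/subsetP => _ /imsetP[_ /imsetP[x xK ->] ->].
by rewrite affS // imset_f // gf4D // gf4M.
Qed.

Lemma agl4P s :
  reflect (exists a b, [/\ a \in gf4, a != 0, b \in gf4 & s = aff a b])
          (s \in H).
Proof.
apply: (iffP idP) => [|[a [b [aK a0 bK ->]]]]; last exact: aff_agl4.
case/setIP=> /setIP[sG /astab1P sN] /astab1P; rewrite setactPE => sK.
have [a a0 [b Es]] := G_fix_inf sG sN; exists a, b.
have sK' x : x \in gf4 -> a * x + b \in gf4.
  move=> xK; have : s (Some x) \in Some @: gf4 by rewrite -sK !imset_f.
  by rewrite Es affS // mem_imset //; apply: Some_inj.
have bK : b \in gf4 by have := sK' 0 gf4_0; rewrite mulr0 add0r.
split=> //; have := gf4D (sK' 1 gf4_1) bK.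
by rewrite mulr1 -addrA (addrr_pchar2 char2) addr0.
Qed.

Lemma agl4_sub : H \subset G.
Proof. by rewrite /= -setIA subsetIl. Qed.

Lemma agl4N s : s \in H -> s None = None.
Proof. by case/setIP=> /setIP[_ /astab1P]. Qed.

(** The fixed point [b / (1 + a)] of [x -> a x + b] has coordinates in GF(4), so
    [H] acts freely outside the projective line over GF(4). *)
Lemma agl4_fix s x : s \in H -> s != 1%g -> s (Some x) = Some x -> x \in gf4.
Proof.
case/agl4P=> a [b [aK a0 bK ->]] s1; rewrite affS // => -[E].
have opp := oppr_pchar2 char2.
have bE : b = (1 + a) * x by rewrite -[a]opp mulrBl mul1r -{1}E; ring.
case: (eqVneq (1 + a) 0) => [a1|a1].
  have aE : a = 1 by apply/eqP; rewrite eq_sym -subr_eq0 opp a1.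
  by move: s1; rewrite bE a1 mul0r aE aff1 eqxx.
rewrite (_ : x = (1 + a)^-1 * b); last by rewrite bE mulKf.
by rewrite gf4M // gf4V // gf4D // gf4_1.
Qed.

Lemma cube_root_sqr x : x ^+ 3 = 1 -> x != 1 -> x * x = x + 1.
Proof.
rewrite -subr_eq0 => x3 x1; have : (x - 1) * (x * x + x + 1) = 0.
  by rewrite -(subrr 1) -{3}x3; ring.
move/eqP; rewrite mulf_eq0 (negPf x1) /= -addrA addr_eq0 (oppr_pchar2 char2).
exact: eqP.
Qed.

Variable w : F.
Hypothesis wE : w * w = w + 1.

Lemma w_neq0 : w != 0.
Proof.
apply: contra_eqN wE => /eqP ->.
by rewrite mul0r add0r eq_sym oner_eq0.
Qed.

Lemma w_neq1 : w != 1.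
Proof.
apply: contra_eqN wE => /eqP ->.
by rewrite mul1r (addrr_pchar2 char2) oner_eq0.
Qed.

Lemma wD1_neq0 : w + 1 != 0.
Proof. by rewrite -wE mulf_neq0 ?w_neq0. Qed.

Lemma w_gf4 : w \in gf4.
Proof.
have dbl := addrr_pchar2 char2.
rewrite inE; apply/eqP; have -> : w ^+ 4 = (w * w) * (w * w) by ring.
rewrite wE; have -> : (w + 1) * (w + 1) = w * w + (1 + 1) * w + 1 by ring.
by rewrite wE dbl mul0r addr0 -addrA dbl addr0.
Qed.

Lemma gf4E : gf4 = [set 0; 1; w; w + 1].
Proof.
have opp := oppr_pchar2 char2.
apply/setP => x; apply/idP/idP => [|]; last first.
  rewrite !in_setU !in_set1 => /orP[/orP[/orP[]|]|] /eqP ->.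
  - exact: gf4_0.
  - exact: gf4_1.
  - exact: w_gf4.
  - by rewrite gf4D ?w_gf4 ?gf4_1.
rewrite !inE -subr_eq0.
have -> : x ^+ 4 - x = x * (x - 1) * (x * (x + 1) + 1) by ring.
have -> : x * (x + 1) + 1 = (x - w) * (x - (w + 1)).
  have -> : (x - w) * (x - (w + 1)) = x * x - (w + w + 1) * x + (w * w + w).
    by ring.
  rewrite wE [w + 1 + w]addrAC (addrr_pchar2 char2) !add0r mul1r opp; ring.
by rewrite !mulf_eq0 !subr_eq0 !orbA.
Qed.

Lemma card_gf4 : #|gf4| = 4%N.
Proof.
have w0 := w_neq0; have w1 := w_neq1.
have w1' := wD1_neq0.
have ww : w != w + 1 by rewrite eq_sym -subr_eq0 addrC addKr oner_eq0.
have w1'' : 1 != w + 1.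
  by rewrite eq_sym -subr_eq0 addrK.
rewrite gf4E -!setUA !cardsU1 cards1 !inE.
rewrite !negb_or ![0 == _]eq_sym (negPf w0) (negPf w1') oner_eq0.
by rewrite (negPf w1'') [1 == w]eq_sym (negPf w1) (negPf ww).
Qed.

Lemma card_agl4 : #|H| = 12%N.
Proof.
have HE : H = (fun u : F * F => aff u.1 u.2) @: setX (gf4 :\ 0) gf4
    :> {set _}.
  apply/setP => s; apply/agl4P/imsetP => [[a [b [aK a0 bK ->]]]|[[a b]]].
    by exists (a, b); rewrite // in_setX in_setD1 a0 aK.
  rewrite in_setX in_setD1 /= => /andP[/andP[a0 aK] bK] ->.
  by exists a, b.
rewrite HE card_in_imset => [|[a b] [c d]]; last first.
  rewrite !in_setX !in_setD1 /= => /andP[/andP[a0 _] _] /andP[/andP[c0 _] _].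
  by case/(aff_inj a0 c0) => -> ->.
have E : #|gf4 :\ 0| = 3%N.
  by apply: succn_inj; rewrite -card_gf4 (cardsD1 0 gf4) gf4_0.
by rewrite cardsX E card_gf4.
Qed.

Lemma card_agl4_orbit x : x \notin gf4 -> #|orbit 'P H (Some x)| = 12%N.
Proof.
move=> xK; rewrite -card_agl4 -(card_orbit_stab 'P H (Some x)).
suff -> : ('C_H[Some x | 'P] = 1)%g by rewrite cards1 muln1.
apply/trivgP/subsetP => s /setIP[sH /astab1P sx]; rewrite inE.
by apply: contraR xK => s1; apply: agl4_fix sH s1 sx.
Qed.

End AffineGF4.

(** * Stabilizers of 13-subsets invariant under AGL(1, 4) *)

Section Stabilizers.

Variables (F : finFieldType) (n : nat).
Hypothesis cardF : #|F| = (2 ^ n)%N.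
Implicit Types (a b c x y : F) (p : option F) (s t g : {perm (option F)}).
Implicit Types (K : {group {perm (option F)}}) (B : {set option F}).

Local Notation G := (PSL2_group F).
Local Notation H := (agl4 F).
Local Notation stab B := ('C_G[B | ('P^*)%act])%g.

Let char2 : 2 \in [pchar F] := card_finPcharP cardF isT.

Lemma translations_group_set : group_set [set aff 1 b | b : F].
Proof.
apply/group_setP; split=> [|_ _ /imsetP[b _ ->] /imsetP[c _ ->]].
  by rewrite -(aff1 F) imset_f.
by rewrite affM ?oner_eq0 // !mul1r imset_f.
Qed.

Definition translations := Group translations_group_set.

Lemma card_translations : #|translations| = (2 ^ n)%N.
Proof.
rewrite /= card_imset ?cardF // => b c /aff_inj.
by case=> //; apply: oner_neq0.
Qed.

(** Conjugating twice shows that [i ^ 2 = 1] modulo the prime 13, which leaves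
    only the exponents 1 and -1. *)
Lemma involution_acts_order13 (gT : finGroupType) (g t : gT) (i : nat) :
  #[g]%g = 13%N -> (t * t = 1)%g -> (g ^ t = g ^+ i)%g ->
  (g ^ t = g \/ g ^ t = g^-1)%g.
Proof.
move=> o13 tt gt.
have gi : (g ^+ (i * i) == g ^+ 1)%g.
  by rewrite expgM -gt -conjXg -gt -conjgM tt conjg1 expg1 eqxx.
have sq1 r : (r < 13 -> (r * r) %% 13 == 1 %% 13 -> r = 1 \/ r = 12)%N.
  by do 13! (case: r => [|r]; first by [|left|right]).
move: gi; rewrite eq_expg_mod_order o13 -modnMm gt -(expg_mod_order g i) o13.
case/(sq1 _ (ltn_pmod i (isT : (0 < 13)%N))) => ->; first by left.
by right; apply/eqP; rewrite eq_sym eq_invg_mul -expgS -o13 expg_order.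
Qed.

Variable w : F.
Hypothesis wE : w * w = w + 1.

Section Overgroup.

Variable K : {group {perm (option F)}}.
Hypotheses (KG : K \subset G) (HK : H \subset K).

(** The translations in [K] form a 2-group whose order divides
    1716 = 4 * 429, so there are no more than the four that [H] contains. *)
Lemma trans_overgroup b : (#|K| %| 1716)%N -> aff 1 b \in K -> b \in gf4 F.
Proof.
move=> K1716 bK.
have T4 : (#|K :&: translations| <= 4)%N.
  have := cardSg (subsetIr K translations).
  rewrite card_translations => /dvdn_pfactor[//|m _ Em].
  have := dvdn_trans (cardSg (subsetIl K translations)) K1716.
  rewrite Em => m1716; case: (leqP m 2) => [|m3].
    exact: (leq_pexp2l (m := 2)).
  by have := dvdn_trans (dvdn_exp2l 2 m3) m1716.
have TE : [set aff 1 c | c in gf4 F] = K :&: translations.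
  apply/eqP; rewrite eqEcard card_in_imset ?(card_gf4 char2 wE) ?T4 ?andbT.
    apply/subsetP => _ /imsetP[c cK ->]; rewrite in_setI imset_f // andbT.
    by apply: (subsetP HK); rewrite aff_agl4 ?gf4_1 ?oner_eq0.
  by move=> c d _ _ /aff_inj[]; rewrite ?oner_eq0.
have : aff 1 b \in K :&: translations by rewrite in_setI bK imset_f.
rewrite -TE => /imsetP[c cK /aff_inj[]]; rewrite ?oner_eq0 // => _ ->.
exact: cK.
Qed.

(** The multiplier [a] of [s] is in GF(4) because [s] conjugates the translation
    by 1 to the translation by [a]; dividing [s] by [x -> a x] then leaves a
    translation. *)
Lemma inf_overgroup s : (#|K| %| 1716)%N -> s \in K -> s None = None -> s \in H.
Proof.
move=> K1716 sK sN.
have [a a0 [b Es]] := G_fix_inf (subsetP KG _ sK) sN; subst s.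
have aK : a \in gf4 F.
  apply: trans_overgroup => //.
  have := affJ b 1 a0 (oner_neq0 _); rewrite mul1r addrK mulr1 => <-.
  by rewrite groupJ // (subsetP HK) // aff_agl4 ?gf4_1 ?oner_eq0.
have a0H : aff a 0 \in H by rewrite aff_agl4 ?gf4_0.
suff bK : aff 1 b \in K by rewrite aff_agl4 // trans_overgroup.
have -> : aff 1 b = ((aff a 0)^-1 * aff a b)%g.
  rewrite affV // affM ?invr_eq0 //; congr aff; first by rewrite divff.
  by rewrite !mulr0 oppr0 mulr0 add0r.
by rewrite groupM // groupV (subsetP HK).
Qed.

(** In a group of order 156 = 12 * 13, Sylow's theorem makes the subgroup of
    order 13 normal. The four translations of [H] act on it through the exponents
    1 and -1, so a nontrivial one centralizes it; since that translation fixes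
    only infinity, the elements of order 13 fix infinity too, and hence lie
    in [H], whose order is 12. *)
Lemma card_overgroup_neq156 :
  (forall s, s \in K -> s None = None -> s \in H) -> #|K| <> 156%N.
Proof.
move=> K_inf K156.
have /normal_sylowP[P sylP nPK] : #|'Syl_13(K)%g| == 1%N.
  (* The only divisor of 156 congruent to 1 modulo 13 is 1. *)
  have := card_Syl_dvd 13 K; have := card_Syl_mod K (p := 13) isT.
  rewrite K156 dvdn_divisors // => m13.
  have -> : divisors 156 = [:: 1; 2; 3; 4; 6; 12; 13; 26; 39; 52; 78; 156]%N.
    by vm_compute.
  rewrite !inE; do ![case/predU1P=> [E|]; first by move: m13; rewrite E].
  by move/eqP=> E; move: m13; rewrite E.
have P13 : #|P| = 13%N by rewrite (card_Hall sylP) K156 p_part.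
have [|g gP g13] := @Cauchy _ 13 P isT; first by rewrite P13.
have gK : g \in K by apply: (subsetP (normal_sub nPK)).
have PE : P = <[g]>%g :> {set _}.
  by apply/esym/eqP; rewrite eqEcard cycle_subG gP P13 -g13 orderE leqnn.
have no_cent c : c \in gf4 F -> c != 0 -> (g ^ aff 1 c)%g <> g.
  move=> cK c0 E.
  have gN : g None = None.
    apply: (trans_fix c0).
    by rewrite -permM conjgC E permM affN.
  have := order_dvdG (K_inf g gK gN).
  by rewrite g13 (card_agl4 char2 wE).
have inv_cent c : c \in gf4 F -> c != 0 -> (g ^ aff 1 c)%g = g^-1%g.
  move=> cK c0; have tK : aff 1 c \in K.
    by rewrite (subsetP HK) // aff_agl4 ?gf4_1 ?oner_eq0.
  have /cycleP[i gi] : (g ^ aff 1 c)%g \in <[g]>%g.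
    by rewrite -PE memJ_norm // (subsetP (normal_norm nPK)).
  case: (involution_acts_order13 g13 _ gi) => // [|E]; last first.
    by case: (no_cent c).
  by rewrite affM ?oner_eq0 // !mul1r (addrr_pchar2 char2) aff1.
have w1 := wD1_neq0 wE.
apply: (no_cent (w + 1)) => //; first by rewrite gf4D ?gf4_1 ?w_gf4.
have -> : aff 1 (w + 1) = (aff 1 w * aff 1 1)%g.
  by rewrite affM ?oner_eq0 // !mul1r.
rewrite conjgM inv_cent ?w_gf4 ?w_neq0 // conjVg.
by rewrite inv_cent ?gf4_1 ?oner_eq0 ?invgK.
Qed.

End Overgroup.

Lemma agl4_stab x : x \notin gf4 F ->
  H \subset stab (None |: orbit 'P H (Some x)).
Proof.
move=> xK; rewrite subsetI agl4_sub; apply/subsetP => s sH; apply/astab1P.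
rewrite setactPE imsetU1 agl4N //; congr (_ |: _).
rewrite -setactPE; apply: astabs_setact.
by apply: subsetP sH; apply: acts_orbit; apply: subsetT.
Qed.

Lemma inf_notin_orbit x : None \notin orbit 'P H (Some x).
Proof.
apply/orbitP => -[s sH] /= /(congr1 s^-1%g); rewrite permK.
by rewrite agl4N ?groupV.
Qed.

Lemma card_block x : x \notin gf4 F ->
  #|None |: orbit 'P H (Some x)| = 13%N.
Proof.
by move=> xK; rewrite cardsU1 (card_agl4_orbit char2 wE) // inf_notin_orbit.
Qed.

(** The orbit of infinity under the stabilizer [K] is a union of orbits of [H]
    inside the block: either infinity alone, and then [K = H] because the elements
    of [K] fixing infinity are in [H], or the whole block, and then
    [K] has order [13 * 12]. *)
Lemma block_stab x : x \notin gf4 F ->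
  stab (None |: orbit 'P H (Some x)) = H.
Proof.
move=> xK; set B := None |: _; set K := (stab B)%G.
have HK : H \subset K := agl4_stab xK.
have KG : K \subset G := subsetIl _ _.
have B13 : #|B| = 13%N := card_block xK.
have K_inf s : s \in K -> s None = None -> s \in H.
  by apply: inf_overgroup; rewrite // card_stab_dvd.
have KB s p : s \in K -> (s p \in B) = (p \in B).
  by case/setIP=> _; rewrite astab1_set => /astabs_act ->.
apply/eqP; rewrite eqEsubset HK andbT; apply/subsetP => s sK.
apply: (K_inf s) => //; case sN: (s None) => [y|] //; exfalso.
apply: (card_overgroup_neq156 HK K_inf).
rewrite -(card_orbit_stab 'P K None).
have -> : 'C_K[None | 'P]%g = H.
  apply/setP => t; apply/setIP/idP => [[tK /astab1P tN]|tH]; first exact: K_inf.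
  by split; [apply: (subsetP HK) | apply/astab1P; apply: agl4N].
rewrite (card_agl4 char2 wE); suff -> : orbit 'P K None = B by rewrite B13.
apply/eqP; rewrite eqEsubset; apply/andP; split.
  by apply/subsetP => _ /orbitP[t tK <-]; rewrite /= apermE KB // setU11.
rewrite subUset sub1set orbit_refl /=.
have yO : Some y \in orbit 'P H (Some x).
  by have := KB s None sK; rewrite sN setU11 in_setU1.
rewrite -(orbit_eqP yO); apply: (subset_trans (B := orbit 'P K (Some y))).
  by apply: imsetS.
have yK : Some y \in orbit 'P K None by apply/orbitP; exists s.
by rewrite (orbit_eqP yK).
Qed.

(** [B] has more points than the projective line over GF(4), so it contains a
    regular orbit of [H]; the remaining point is fixed by [H]. *)
Lemma invariant_block B : #|B| = 13%N -> H \subset stab B ->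
  exists2 x, x \notin gf4 F & B = None |: orbit 'P H (Some x).
Proof.
move=> B13; rewrite subsetI astab1_set => /andP[_ HB].
have /subsetPn[p pB pL] : ~~ (B \subset None |: [set Some y | y in gf4 F]).
  apply/negP => /subset_leq_card; rewrite B13 leqNgt ltnS.
  rewrite (leq_trans (leq_card_setU _ _)) // cards1.
  rewrite card_imset; last exact: Some_inj.
  by rewrite (card_gf4 char2 wE).
case: p pB pL => [x|] xB; last by rewrite setU11.
rewrite in_setU1 /= mem_imset; last exact: Some_inj.
move=> xK; exists x => //; set O := orbit _ _ _.
have OB : O \subset B by rewrite acts_sub_orbit.
have /cards1P[p Ep] : #|B :\: O| == 1%N.
  by rewrite cardsD (setIidPr OB) B13 (card_agl4_orbit char2 wE).
have t1H : aff 1 1 \in H by rewrite aff_agl4 ?gf4_1 ?oner_eq0.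
suff pN : p = None.
  by rewrite -(setID B O) (setIidPr OB) Ep pN setUC.
apply: (trans_fix (oner_neq0 F)); apply/set1P; rewrite -Ep.
have /setDP[pB pO] : p \in B :\: O by rewrite Ep set11.
rewrite in_setD -[aff 1 1 p]/('P%act p (aff 1 1)).
rewrite (astabs_act _ (subsetP HB _ t1H)) pB andbT.
by rewrite (astabs_act _ (subsetP (acts_orbit _ _ (subsetT _)) _ t1H)).
Qed.

(** A normalizing [g] preserves infinity, the only fixed point of [H], so it is
    some [x -> a x + b]; reading off the translation parts of the conjugates of
    [x -> x + 1] and [x -> w x] puts [a] and [(w + 1) b] in GF(4). *)
Lemma agl4_self_normalizing g : g \in G -> (H :^ g)%g = H -> g \in H.
Proof.
move=> gG Hg.
have HJ s : s \in H -> (s ^ g)%g \in H by rewrite -{2}Hg memJ_conjg.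
have t1H : aff 1 1 \in H by rewrite aff_agl4 ?gf4_1 ?oner_eq0.
have gN : g None = None.
  apply: (trans_fix (oner_neq0 F)); move: t1H; rewrite -Hg => /imsetP[s sH ->].
  by rewrite conjgE !permM permK agl4N.
have [a a0 [b Eg]] := G_fix_inf gG gN; subst g.
have shiftK c d : c != 0 -> aff c d \in H -> d \in gf4 F.
  move=> c0 /(agl4P char2)[c' [d' [_ c0' dK /aff_inj]]].
  by case=> // _ ->.
have aK : a \in gf4 F.
  have := HJ _ t1H; rewrite affJ ?oner_eq0 // mul1r addrK mulr1.
  exact/shiftK/oner_neq0.
have w0 := w_neq0 wE.
have w1 := wD1_neq0 wE.
have bK : (w + 1) * b \in gf4 F.
  have wH : aff w 0 \in H by rewrite aff_agl4 ?gf4_0 ?w_gf4.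
  have := HJ _ wH; rewrite affJ //.
  rewrite mulr0 add0r -mulNr (oppr_pchar2 char2) mulrDl mul1r addrC.
  exact: shiftK.
rewrite aff_agl4 // -(mulKf w1 b) gf4M // gf4V // gf4D ?gf4_1 //.
exact: w_gf4.
Qed.

End Stabilizers.

(** * Subgroups of order 12 *)

Section Order12.

Variables (F : finFieldType) (n : nat).
Hypothesis cardF : #|F| = (2 ^ n)%N.
Implicit Types (K : {group {perm (option F)}}) (s g : {perm (option F)}).

Local Notation G := (PSL2_group F).
Local Notation H := (agl4 F).

Let char2 : 2 \in [pchar F] := card_finPcharP cardF isT.

Lemma odd_card_projline : odd #|{: option F}|.
Proof.
rewrite card_projline cardF /= oddX negb_or; case: n cardF => // F1.
by have := finNzRing_gt1 F; rewrite F1.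
Qed.

(** In characteristic 2, [a ^ 4 = 1] reads [(a - 1) ^ 4 = 0]: the affine elements
    of a 2-group of exponent dividing 4 are translations. *)
Lemma aff_order_dvd4 a b : a != 0 -> (aff a b ^+ 4 = 1)%g -> a = 1 :> F.
Proof.
move=> a0; rewrite !expgS expg0 mulg1 !affM ?mulf_neq0 //.
rewrite -(aff1 F) => /aff_inj[]; rewrite ?mulf_neq0 ?oner_neq0 // => E _.
have a4 : a ^+ 4 = 1 by rewrite -E; ring.
have dbl := addrr_pchar2 char2.
have : (a - 1) ^+ 4 = 0.
  have -> : (a - 1) ^+ 4 = a ^+ 4 - 1 +
     (1 - 2 * a ^+ 3 + 3 * a ^+ 2 - 2 * a) * (1 + 1) by ring.
  by rewrite dbl mulr0 addr0 a4 subrr.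
by move/eqP; rewrite expf_eq0 /= subr_eq0 => /eqP.
Qed.

Lemma trans_semiregular s (x : F) : s \in G -> s None = None ->
  (s ^+ 4 = 1)%g -> s (Some x) = Some x -> s = 1%g.
Proof.
move=> sG sN s4; have [a a0 [b Es]] := G_fix_inf sG sN.
have a1 : a = 1 by apply: (aff_order_dvd4 (b := b)); rewrite -?Es.
rewrite Es a1; case: (eqVneq b 0) => [-> _|b0 /(trans_fix b0) //].
exact: aff1.
Qed.

(** A Sylow 2-subgroup [S] fixing infinity consists of translations, hence acts
    freely on the finite points. The [K]-orbit of infinity has size 1 or 3,
    and size 3 would leave an [S]-invariant set of only two finite points. *)
Lemma order12_fix_inf K (S : {group {perm (option F)}}) :
  K \subset G -> #|K| = 12%N -> S \subset K -> #|S| = 4%N ->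
  (forall s, s \in S -> s None = None) ->
  forall s, s \in K -> s None = None.
Proof.
move=> KG K12 SK S4 SN s sK; case sN: (s None) => [y|] //; exfalso.
set O := orbit 'P K None.
have yO : Some y \in O by apply/orbitP; exists s.
have O3 : (#|O| <= 3)%N.
  rewrite -(leq_pmul2r (m := 4)) // -[(3 * 4)%N]/12%N -K12.
  rewrite -(card_orbit_stab 'P K None) leq_mul2l; apply/orP; right.
  rewrite -S4 subset_leq_card // subsetI SK; apply/subsetP => t tS.
  by apply/astab1P; apply: SN.
have SO : #|orbit 'P S (Some y)| = 4%N.
  rewrite -S4 -(card_orbit_stab 'P S (Some y)).
  suff -> : ('C_S[Some y | 'P] = 1)%g by rewrite cards1 muln1.
  apply/trivgP/subsetP => t /setIP[tS /astab1P ty]; apply/set1P.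
  apply: (trans_semiregular _ (SN t tS)) ty.
    exact: (subsetP (subset_trans SK KG)).
  by apply/eqP; rewrite -order_dvdn -S4 order_dvdG.
suff /subset_leq_card : orbit 'P S (Some y) \subset O.
  by rewrite SO leqNgt ltnS O3.
by rewrite /O -(orbit_eqP yO); apply: imsetS.
Qed.

(** The Sylow 2-subgroup has a fixed point because the projective line has odd
    size; moving it to infinity makes [K] affine. An element of order 3 has a
    multiplier [w] of order 3 and a finite fixed point; moving that point to 0
    and scaling a translation of [K] to length 1 puts the generators
    of [agl4] into the conjugate of [K]. *)
Lemma order12_conj K : K \subset G -> #|K| = 12%N ->
  exists2 w : F, w * w = w + 1 & exists2 g, g \in G & (K :^ g)%g = H.
Proof.
move=> KG K12.
have [S sylS] := Sylow_exists 2 K.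
have S4 : #|S| = 4%N by rewrite (card_Hall sylS) K12 p_part.
have [p pS] : exists p, p \in 'Fix_([set: option F] | 'P)(S)%g.
  have actS : [acts S, on [set: option F] | 'P].
    by apply/actsP => s _ x; rewrite !inE.
  have := pgroup_fix_mod (pHall_pgroup sylS) actS.
  rewrite cardsT !modn2 odd_card_projline => E.
  by apply/set0Pn; apply: contra_eqN E => /eqP ->; rewrite cards0.
have [h hG hp] := G_to_inf p.
have KhG : (K :^ h \subset G)%g by rewrite -(conjGid hG) conjSg.
have ShN s : s \in (S :^ h)%g -> s None = None.
  case/imsetP=> t tS ->; rewrite -hp -permM -conjgC permM; congr (h _).
  by move: pS; rewrite in_setI => /andP[_ /afixP/(_ t tS)].
have Kh12 : #|(K :^ h)%g| = 12%N by rewrite cardJg.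
have ShK : (S :^ h \subset K :^ h)%g by rewrite conjSg (pHall_sub sylS).
have KhN : forall s, s \in (K :^ h)%g -> s None = None.
  by apply: order12_fix_inf KhG Kh12 ShK _ ShN; rewrite cardJg.
have [|z zK z3] := @Cauchy _ 3 (K :^ h)%G isT; first by rewrite Kh12.
have [w w0 [b Ez]] := G_fix_inf (subsetP KhG _ zK) (KhN z zK).
have w1 : w != 1.
  apply/eqP => wE.
  have : (#[z]%g %| 2)%N.
    rewrite order_dvdn Ez wE expgS expg1 affM ?oner_eq0 // !mul1r.
    by rewrite (addrr_pchar2 char2) aff1.
  by rewrite z3.
have wE : w * w = w + 1.
  have := expg_order z; rewrite z3 Ez !expgS expg0 mulg1 !affM ?mulf_neq0 //.
  rewrite -(aff1 F) => /aff_inj[]; rewrite ?mulf_neq0 ?oner_neq0 // => E _.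
  by apply: (cube_root_sqr char2) => //; rewrite -E; ring.
exists w => //.
have [|t tS t2] := @Cauchy _ 2 (S :^ h)%G isT; first by rewrite cardJg S4.
have tK := subsetP ShK _ tS.
have [a a0 [c Et]] := G_fix_inf (subsetP KhG _ tK) (KhN t tK).
have a1 : a = 1.
  apply: (aff_order_dvd4 (b := c)); rewrite -?Et //.
  by apply/eqP; rewrite -order_dvdn t2.
have c0 : c != 0.
  by apply: contra_eqN t2 => /eqP c0; rewrite Et a1 c0 aff1 order1.
have w1' := wD1_neq0 wE.
(* [b / (w + 1)] is the finite fixed point of the element of order 3. *)
pose e := aff c^-1 (c^-1 * (b / (w + 1))).
exists (h * e)%g; first by rewrite groupM // aff_G ?invr_eq0.
have wK : aff w 0 \in (K :^ (h * e))%g.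
  have -> : aff w 0 = (z ^ e)%g.
    rewrite Ez affJ ?invr_eq0 //; congr aff.
    have -> : c^-1 * b + c^-1 * (b / (w + 1)) - w * (c^-1 * (b / (w + 1))) =
      c^-1 * (b / (w + 1)) * (1 + 1) by field; rewrite w1' c0.
    by rewrite (addrr_pchar2 char2) mulr0.
  by rewrite conjsgM memJ_conjg.
have oneK : aff 1 1 \in (K :^ (h * e))%g.
  have -> : aff 1 1 = (t ^ e)%g.
    by rewrite Et a1 affJ ?oner_eq0 ?invr_eq0 // mul1r addrK mulVf.
  by rewrite conjsgM memJ_conjg.
have twK : aff 1 w \in (K :^ (h * e))%g.
  have -> : aff 1 w = (aff 1 1 ^ aff w 0)%g.
    by rewrite affJ ?oner_neq0 // mulr1 mul1r addrK.
  by rewrite groupJ.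
apply/esym/eqP; rewrite eqEcard cardJg K12 (card_agl4 char2 wE) leqnn andbT.
have transK d : d \in gf4 F -> aff 1 d \in (K :^ (h * e))%g.
  rewrite (gf4E char2 wE) !in_setU !in_set1 => /orP[/orP[/orP[]|]|] /eqP -> //.
    by rewrite aff1 group1.
  have -> : aff 1 (w + 1) = (aff 1 w * aff 1 1)%g.
    by rewrite affM ?oner_eq0 // !mul1r.
  by rewrite groupM.
have scaleK a' : a' \in gf4 F -> a' != 0 -> aff a' 0 \in (K :^ (h * e))%g.
  rewrite (gf4E char2 wE) !in_setU !in_set1 => /orP[/orP[/orP[]|]|] /eqP -> //.
  - by rewrite eqxx.
  - by rewrite aff1 group1.
  have -> : aff (w + 1) 0 = (aff w 0 * aff w 0)%g.
    by rewrite affM // mulr0 addr0 wE.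
  by rewrite groupM.
apply/subsetP => _ /(agl4P char2)[a' [d [aK a'0 dK ->]]].
have -> : aff a' d = (aff a' 0 * aff 1 d)%g.
  by rewrite affM ?oner_eq0 // !mul1r add0r.
by rewrite groupM ?scaleK ?transK.
Qed.

End Order12.

(** * Counting the orbits *)

Section Counting.

Variables (F : finFieldType) (n : nat).
Hypothesis cardF : #|F| = (2 ^ n)%N.

Local Notation G := (PSL2_group F).
Local Notation H := (agl4 F).
Local Notation stab B := ('C_G[B | ('P^*)%act])%g.
Local Notation orb B := (orbit ('P^*)%act G B).

Let char2 : 2 \in [pchar F] := card_finPcharP cardF isT.

Definition regular_orbits : {set {set option F}} :=
  [set orbit 'P H p | p in [set Some x | x in ~: gf4 F]].

Lemma stab_conj (B : {set option F}) g : g \in G ->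
  stab (('P^*)%act B g) = (stab B :^ g)%g.
Proof. by move=> gG; rewrite conjIg conjGid // astab1_act. Qed.

Lemma m_lambda143_eq0 :
  (forall w : F, w * w != w + 1) -> m_lambda F 143 = 0%N.
Proof.
move=> no_w; apply/eqP; rewrite cards_eq0; apply/eqP/setP => D.
rewrite in_set0; apply/negP => /setIdP[/imsetP[B]].
rewrite inE => /eqP B13 ->; rewrite simple_designE // => /eqP K12.
have [w wE _] := order12_conj cardF (K := (stab B)%G) (subsetIl _ _) K12.
by move: (no_w w); rewrite wE eqxx.
Qed.

Variable w : F.
Hypothesis wE : w * w = w + 1.

Lemma card_regular_orbits : (#|regular_orbits| * 12 = 2 ^ n - 4)%N.
Proof.
have <- : #|[set Some x | x in ~: gf4 F]| = (2 ^ n - 4)%N.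
  rewrite card_imset; last exact: Some_inj.
  by rewrite cardsCs setCK (card_gf4 char2 wE) cardF.
symmetry; apply: card_uniform_partition.
  move=> _ /imsetP[_ /imsetP[x xK ->] ->].
  by rewrite (card_agl4_orbit char2 wE) // -in_setC.
apply: orbit_partition; apply/actsP => s sH p.
have finE q : (q \in [set Some x | x in ~: gf4 F]) =
    (q != None) && (q \notin [set Some x | x in gf4 F]).
  case: q => [x|] /=; last by apply/imsetP => -[].
  by rewrite !(mem_imset _ _ (@Some_inj _)) in_setC.
have sK : s \in 'N([set Some x | x in gf4 F] | 'P)%g.
  by rewrite -astab1_set; case/setIP: sH.
rewrite !finE (astabs_act _ sK) -{1}(agl4N sH).
by rewrite /= apermE (inj_eq (@perm_inj _ s)).
Qed.

(** Each orbit of blocks with stabilizer of order 12 contains a block with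
    stabilizer exactly [H]; two such blocks in one orbit differ by an element
    normalizing [H], that is, by an element of [H], which preserves both. *)
Lemma m_lambda143_regular : m_lambda F 143 = #|regular_orbits|.
Proof.
pose f (O : {set option F}) : {set {set option F}} := orb (None |: O).
have fi : {in regular_orbits &, injective f}.
  move=> _ _ /imsetP[_ /imsetP[x xK ->] ->] /imsetP[_ /imsetP[y yK ->] ->].
  rewrite in_setC in xK; rewrite in_setC in yK; rewrite /f => E.
  have /orbitP[g gG Eg] : None |: orbit 'P H (Some y) \in
    orb (None |: orbit 'P H (Some x)) by rewrite E orbit_refl.
  have Hg : (H :^ g)%g = H.
    rewrite -{1}(block_stab cardF wE xK) -stab_conj //.
    by rewrite -[RHS](block_stab cardF wE yK) -Eg.
  have gH := agl4_self_normalizing cardF wE gG Hg.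
  have gx := subsetP (agl4_stab xK) g gH.
  rewrite -(setU1K (inf_notin_orbit x)) -(setU1K (inf_notin_orbit y)) -Eg.
  congr (_ :\ _).
  by case/setIP: gx => _ /astab1P.
rewrite -(card_in_imset fi); apply: eq_card => D; apply/setIdP/imsetP.
  case=> /imsetP[B]; rewrite inE => /eqP B13 ->.
  rewrite simple_designE // => /eqP K12.
  have [_ _ [g gG Hg]] :=
    order12_conj cardF (K := (stab B)%G) (subsetIl _ _) K12.
  have B'13 : #|('P^*)%act B g| = 13%N.
    by rewrite setactPE card_imset //; apply: perm_inj.
  have [|x xK Ex] := invariant_block cardF wE B'13.
    by rewrite stab_conj // Hg.
  exists (orbit 'P H (Some x)).
    by rewrite imset_f // imset_f // in_setC.
  rewrite /f -Ex; apply/esym/orbit_eqP; exact: mem_orbit.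
case=> _ /imsetP[_ /imsetP[x xK ->] ->] ->; rewrite in_setC in xK.
have B13 := card_block cardF wE xK.
rewrite /f simple_designE // (block_stab cardF wE xK) (card_agl4 char2 wE).
by rewrite imset_f // inE B13.
Qed.

End Counting.

Lemma pow2_mod3 n : (2 ^ n %% 3 = if odd n then 2 else 1)%N.
Proof.
rewrite -[n in LHS]odd_double_half expnD -mul2n expnM -modnMmr.
by rewrite -modnXm exp1n; case: (odd n).
Qed.

Theorem proposition5p12 (n : nat) (hn : (1 <= n)%N)
    (F : finFieldType) (hF : #|F| = (2 ^ n)%N) :
  (m_lambda F 143)%:R = (if odd n then 0 else (2 ^+ n - 4) / 12) :> rat.
Proof.
have char2 := card_finPcharP hF isT.
case: ifP => on.
  rewrite (m_lambda143_eq0 hF) // => w; apply/eqP => wE.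
  have w3 : w ^+ 3 = 1.
    have -> : w ^+ 3 = w * (w * w) by ring.
    rewrite wE mulrDr mulr1 wE [w + 1 + w]addrAC (addrr_pchar2 char2) add0r //.
  (* As [2 ^ n = 2] modulo 3, the identity [w ^ (2 ^ n) = w] gives [w ^ 2 = w]. *)
  have := expf_card w.
  rewrite hF (divn_eq (2 ^ n) 3) pow2_mod3 on exprD mulnC exprM.
  rewrite w3 expr1n mul1r => /eqP; rewrite -subr_eq0 expr2 wE.
  by rewrite addrAC subrr add0r oner_eq0.
have [|u _ u3] := @Cauchy _ 3 [set: {unit F}] isT.
  rewrite card_finField_unit hF -subn1 -eqn_mod_dvd ?expn_gt0 //.
  by rewrite pow2_mod3 on.
pose w := FinRing.uval u.
have w3 : w ^+ 3 = 1.
  by rewrite -FinRing.val_unitX -u3 expg_order.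
have w1 : w != 1.
  apply: contra_eqN u3 => /eqP w1.
  by have -> : u = 1%g by [apply: val_inj]; rewrite order1.
have wE := cube_root_sqr char2 w3 w1.
have n2 : (4 <= 2 ^ n)%N.
  by rewrite -[4%N]/(2 ^ 2)%N leq_exp2l //; case: (n) hn on => [|[|m]].
have := congr1 (fun k => k%:R : rat) (card_regular_orbits hF wE).
rewrite (m_lambda143_regular hF wE) natrM natrB // natrX => <-.
by rewrite mulfK.
Qed.
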